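(* Let $0<p<1$ and $d\geq 2$, and let $\mathcal{G}=(\mathcal{V},\mathcal{E})$ be the random graph on the open vertices of $\mathbb{Z}^d$ with parameter $p$ defined in the context. Then $\mathcal{G}$ contains no bi-infinite path $\mathbb{P}$-almost surely.
   Context: Write $u=(u(1),\ldots,u(d))$ for $u\in\mathbb{Z}^d$. Let $\Omega=\{0,1\}^{\mathbb{Z}^d}$ with the product $\sigma$-algebra $\mathcal{F}$ and the product measure $P_p$ under which the coordinates $\omega(u)$, $u\in\mathbb{Z}^d$, are independent with $P_p(\omega(u)=1)=p=1-P_p(\omega(u)=0)$. Let $\{U_{u,v}: u,v\in\mathbb{Z}^d,\ v(d)=u(d)-1\}$ be i.i.d. uniform $(0,1]$ random variables on a probability space $(\Xi,\mathcal{S},\mu)$, and work on $(\Omega\times\Xi,\mathcal{F}\times\mathcal{S},\mathbb{P}:=P_p\times\mu)$. A vertex $u$ is open if $\omega(u)=1$; $\mathcal{V}=\{u\in\mathbb{Z}^d:\omega(u)=1\}$ is the set of open vertices. For every $u\in\mathbb{Z}^d$ (open or not) let $N_u$ be the set of those $v\in\mathcal{V}$ with $v(d)=u(d)-1$ that minimize $\sum_{i=1}^d|w(i)-u(i)|$ among all $w\in\mathcal{V}$ with $w(d)=u(d)-1$. For $p>0$, $N_u$ is almost surely nonempty; let $h(u)\in N_u$ be the (almost surely unique) element with $U_{u,h(u)}=\min\{U_{u,v}:v\in N_u\}$. Let $\mathcal{E}=\{\langle u,h(u)\rangle:u\in\mathcal{V}\}$ (undirected edges) and $\mathcal{G}=(\mathcal{V},\mathcal{E})$.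 A bi-infinite path is a doubly infinite sequence $(x_k)_{k\in\mathbb{Z}}$ of distinct vertices of $\mathcal{G}$ such that $\langle x_k,x_{k+1}\rangle\in\mathcal{E}$ for all $k\in\mathbb{Z}$. *)

(* Defs.v *)
From HB Require Import structures.
From mathcomp Require Import all_boot all_order all_algebra finmap.
From mathcomp Require Import all_classical all_reals all_analysis.

Set Implicit Arguments.
Unset Strict Implicit.
Unset Printing Implicit Defensive.

Import Order.TTheory GRing.Theory Num.Theory.

Local Open Scope classical_set_scope.
Local Open Scope ring_scope.

Definition mutually_independent {d d' : measure_display} {T : measurableType d}
    {T' : measurableType d'} {R : realType} (P : probability T R)
    {I : choiceType} (D : set I) (X : I -> T -> T') : Prop :=
  forall (J : {fset I}) (A : I -> set T'),
    [set` J] `<=` D ->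
    (forall i, i \in J -> measurable (A i)) ->
    P (\bigcap_(i in [set` J]) (X i @^-1` A i)) =
      (\prod_(i <- J) P (X i @^-1` A i))%E.

Definition lattice (d : nat) := {ffun 'I_d -> int}.

(** The last coordinate [u(d)]; the value in dimension [0] is a dummy. *)
Definition height {d : nat} : lattice d -> int :=
  match d with
  | 0%N => fun _ => 0
  | n.+1 => fun u => u ord_max
  end.

Definition l1_dist {d : nat} (u v : lattice d) : int := \sum_i `|v i - u i|.

Definition cylinders (d : nat) : set (set (lattice d -> bool)) :=
  \bigcup_u preimage_set_system setT (fun w : lattice d -> bool => w u)
    measurable.

(** [{0,1}^(Z^d)] with the product sigma-algebra. *)
Definition config (d : nat) := g_sigma_algebraType (@cylinders d).

(** The cylinder probabilities determine [P], so this says that [P] is the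
    product measure [P_p]. *)
Definition is_bernoulli_product {R : realType} {d : nat} (p : R)
    (P : probability (config d) R) : Prop :=
  mutually_independent P setT (fun (u : lattice d) (w : config d) => w u) /\
  forall u : lattice d, P [set w : config d | w u = true] = p%:E.

Definition one_below {d : nat} : set (lattice d * lattice d) :=
  [set e | height e.2 = height e.1 - 1].

Definition uniform01 {R : realType} {dX : measure_display}
    {Xi : measurableType dX} (mu : probability Xi R) (X : {RV mu >-> R}) : Prop :=
  forall A : set R, measurable A ->
    mu (X @^-1` A) = lebesgue_measure (A `&` `]0, 1]%classic).

(** Only the [U e] with [e] in [one_below] are constrained (and, below, used). *)
Definition iid_uniform01 {R : realType} {d : nat} {dX : measure_display}
    {Xi : measurableType dX} (mu : probability Xi R)
    (U : lattice d * lattice d -> {RV mu >-> R}) : Prop :=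
  mutually_independent mu one_below (fun e => U e : Xi -> R) /\
  forall e, one_below e -> uniform01 (U e).

Section Graph.
Context {R : realType} {d : nat}.
Variables (w : lattice d -> bool) (U : lattice d * lattice d -> R).

Definition open_vertices : set (lattice d) := [set u | w u = true].

Definition open_below (u : lattice d) : set (lattice d) :=
  open_vertices `&` [set v | height v = height u - 1].

Definition nearest (u : lattice d) : set (lattice d) :=
  [set v | open_below u v /\
           forall v', open_below u v' -> l1_dist u v <= l1_dist u v'].

(** [xget] picks a minimiser of [U (u, _)] on [nearest u]; the default [u] is
    only reached when [nearest u] is empty, which, like a tie between several
    minimisers, is a null event. *)
Definition ancestor (u : lattice d) : lattice d :=
  xget u [set v | nearest u v /\
                  forall v', nearest u v' -> U (u, v) <= U (u, v')].

Definition edge (x y : lattice d) : Prop :=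
  exists2 u, open_vertices u &
    (x = u /\ y = ancestor u) \/ (x = ancestor u /\ y = u).

Definition bi_infinite_path (x : int -> lattice d) : Prop :=
  [/\ injective x,
      forall k : int, open_vertices (x k) &
      forall k : int, edge (x k) (x (k + 1))].

End Graph.

(* Main.v *)
Require Import Defs.
From mathcomp Require Import all_boot all_order all_algebra.
From mathcomp Require Import finmap zify.
From mathcomp Require Import all_classical all_reals all_analysis.
Import Order.TTheory GRing.Theory Num.Theory.
Local Open Scope classical_set_scope.
Local Open Scope ring_scope.

(* Every bi-infinite path contains a vertex v having, for every n, a chain of n
   successive descendants above it ("eternal" below).  Let a_n be the probability
   of having a chain of length n.  A vertex sends mass one to its parent when it has
   a chain of length n; translation invariance balances mass sent and received, so
   a_n is at least a_{n+1} plus the probability that two given vertices u1, u2 are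
   both children of v with chains of length n.  If eternal vertices had positive
   probability, two distinct eternal vertices u1, u2 would exist on one level with
   positive probability; independently of everything on or above that level, the
   level below may be closed near them except at a single v, making u1 and u2
   siblings.  Then a_n would decrease by a fixed amount at every step. *)

(** * Measure-theoretic preliminaries *)

(** Dynkin's argument: the sets with measurable preimages of equal mass form a lambda system. Both
    the measure and the map may differ, which serves translation invariance (two maps) as well as
    independence (two measures). *)
Lemma pi_lambda_agree {dT : measure_display} {T : measurableType dT} {R : realType}
    (m1 m2 : {measure set T -> \bar R}) {Y : Type} (f1 f2 : T -> Y)
    (G : set (set Y)) :
  setI_closed G -> (m1 setT < +oo)%E -> m1 setT = m2 setT ->
  (forall B, G B -> [/\ measurable (f1 @^-1` B), measurable (f2 @^-1` B) &
                        m1 (f1 @^-1` B) = m2 (f2 @^-1` B)]) ->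
  forall B, <<s G >> B -> [/\ measurable (f1 @^-1` B), measurable (f2 @^-1` B) &
                        m1 (f1 @^-1` B) = m2 (f2 @^-1` B)].
Proof.
move=> GI m1oo m12 GE; apply: lambda_system_subset => //.
have m2oo : (m2 setT < +oo)%E by rewrite -m12.
apply/dynkin_lambda_system; split.
- by rewrite !preimage_setT.
- move=> B [mB1 mB2 B12]; rewrite -(preimage_setC f1) -(preimage_setC f2); split;
    [exact: measurableC|exact: measurableC|].
  have mC (m : {measure set T -> \bar R}) A : measurable A ->
      (m setT < +oo)%E -> m (~` A) = (m setT - m A)%E.
    by move=> mA moo; rewrite -setTD measureD// setTI.
  by rewrite !mC// m12 B12.
- move=> F tF GF; rewrite (preimage_bigcup _ f1) (preimage_bigcup _ f2).
  have mF1 k : measurable (f1 @^-1` F k) by have [] := GF k.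
  have mF2 k : measurable (f2 @^-1` F k) by have [] := GF k.
  split; [exact: bigcupT_measurable|exact: bigcupT_measurable|].
  have tFf (f : T -> Y) : trivIset setT (fun k => f @^-1` F k).
    by move=> i j _ _ [x [Fi Fj]]; apply: tF => //; exists (f x).
  rewrite !measure_bigcup//.
  by apply: eq_eseriesr => k _; have [] := GF k.
Qed.

(** Removing from each [F k] the earlier sets discards only null sets, and the pieces left are
    disjoint subsets of [B]. *)
Lemma almost_disjoint_series {dT : measure_display} {T : measurableType dT}
    {R : realType} (m : {measure set T -> \bar R}) (F : (set T)^nat) (B : set T) :
  measurable B -> (forall k, measurable (F k)) -> (forall k, F k `<=` B) ->
  (forall i j, i <> j -> m (F i `&` F j) = 0%E) ->
  (\sum_(0 <= k <oo) m (F k) <= m B)%E.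
Proof.
move=> mB mF FB F0.
have mG k : measurable (seqDU F k) by exact: seqDU_measurable.
have -> : (\sum_(0 <= k <oo) m (F k) = \sum_(0 <= k <oo) m (seqDU F k))%E.
  apply: eq_eseriesr => k _.
  have mU : measurable (\big[setU/set0]_(j < k) F j) by exact: bigsetU_measurable.
  rewrite /seqDU (measureDI m (mF k) mU).
  rewrite [X in (_ + X)%E](_ : _ = 0%E) ?adde0//.
  apply/eqP; rewrite -measure_le0.
  rewrite big_distrr/=.
  have mI (i : nat) : (i < k)%N -> measurable (F k `&` F i) by move=> _; exact: measurableI.
  apply: (le_trans (le_mu_bigsetU m mI)).
  rewrite big1// => i _; apply: F0 => ki.
  by have := ltn_ord i; rewrite -ki ltnn.
have -> : (\sum_(0 <= k <oo) m (seqDU F k) = m (\bigcup_k seqDU F k))%E.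
  rewrite measure_bigcup//.
  by apply: eq_eseriesl => k; rewrite in_setT.
rewrite -seqDU_bigcup_eq le_measure//.
- by rewrite inE; exact: bigcupT_measurable.
- by rewrite inE.
- by move=> x [k _ /FB].
Qed.

(** Replacing [F j] by its part outside [F i] keeps the union and lowers the series by exactly the
    mass of the overlap; countable subadditivity then applies to the reduced family. *)
Lemma subadditive_overlap {dT : measure_display} {T : measurableType dT}
    {R : realType} (m : {measure set T -> \bar R}) (F : (set T)^nat) (B : set T)
    (i j : nat) :
  measurable B -> (forall k, measurable (F k)) -> B `<=` \bigcup_k F k ->
  (m setT < +oo)%E -> i <> j ->
  (m B + m (F i `&` F j) <= \sum_(0 <= k <oo) m (F k))%E.
Proof.
move=> mB mF BF moo ij.
pose G k := if k == j then F j `\` F i else F k.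
have mG k : measurable (G k) by rewrite /G; case: ifP => _ //; exact: measurableD.
have BG : B `<=` \bigcup_k G k.
  move=> x /BF [k _ Fk]; have [Fi|nFi] := pselect (F i x).
    by exists i => //; rewrite /G; case: eqP.
  by exists k => //; rewrite /G; case: eqP => // kj; split=> //; rewrite -kj.
rewrite (@nneseriesD1 _ (fun k => m (F k)) j)//.
have := measure_sigma_subadditive m mG mB BG.
rewrite (@nneseriesD1 _ (fun k => m (G k)) j)// /G eqxx => h.
rewrite (measureDI m (mF j) (mF i)) (setIC (F i)) addeAC leeD2r//.
apply: (le_trans h); rewrite leeD2l// le_eqVlt; apply/orP; left; apply/eqP.
by apply: eq_eseriesr => k /negPf ->.
Qed.

(** * Lattice translations, environments and cylinder events *)

Lemma height_add d (u v : lattice d) : height (u + v) = height u + height v.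
Proof. by case: d u v => [|n] u v /=; rewrite ?addr0// ffunE. Qed.

Lemma l1_dist_add d (a u v : lattice d) : l1_dist (u + a) (v + a) = l1_dist u v.
Proof.
by apply: eq_bigr => i _; rewrite !ffunE opprD addrACA subrr addr0.
Qed.

Lemma mutually_independent_reindex {dT dV : measure_display}
    {T : measurableType dT} {V : measurableType dV} {R : realType}
    (P : probability T R) {I : choiceType} (D D' : set I) (X : I -> T -> V)
    (f g : I -> I) :
  cancel f g -> (forall i, D' i -> D (f i)) ->
  mutually_independent P D X -> mutually_independent P D' (fun i => X (f i)).
Proof.
move=> fK DD' XI J A JD' mA.
have := XI [fset f i | i in J]%fset (A \o g).
rewrite big_imfset/=; last by move=> i j _ _; exact: (can_inj fK).
under eq_bigr do rewrite fK.
move=> <-.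
- congr (P _); apply/seteqP; split=> [t Xt j /imfsetP[i /= iJ ->]|t Xt i iJ].
    by rewrite /= fK; exact: Xt.
  have := Xt (f i); rewrite /= fK; apply.
  by apply/imfsetP; exists i.
- by move=> j /imfsetP[i /= iJ ->]; apply: DD'; exact: JD'.
- by move=> j /imfsetP[i /= iJ ->]; rewrite fK; exact: mA.
Qed.

Section Environment.
Context {R : realType} {d : nat}.

(** Plain pairs of functions: measurability is expressed through the sigma-algebras generated by
    [cylinders_above h] and pulled back to the probability space later. *)
Definition env : Type := ((lattice d -> bool) * (lattice d * lattice d -> R))%type.

Definition cylinder (J1 : {fset lattice d}) (A1 : lattice d -> set bool)
    (J2 : {fset lattice d * lattice d}) (A2 : lattice d * lattice d -> set R) :
    set env :=
  [set y | (forall u, u \in J1 -> A1 u (y.1 u)) /\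
           (forall e, e \in J2 -> A2 e (y.2 e))].

Definition sites_above (h : int) : set (lattice d) := [set u | h <= height u].

(** An edge is placed at the level of its lower endpoint, so both endpoints lie at height at least
    [h]. *)
Definition edges_above (h : int) : set (lattice d * lattice d) :=
  [set e | one_below e /\ h <= height e.2].

Definition cylinders_above (h : int) : set (set env) :=
  [set B | exists J1 A1 J2 A2, [/\ [set` J1] `<=` sites_above h,
     [set` J2] `<=` edges_above h, (forall e, measurable (A2 e)) &
     B = cylinder J1 A1 J2 A2]].

Lemma cylinders_above_setI h : setI_closed (cylinders_above h).
Proof.
move=> _ _ [J1 [A1 [J2 [A2 [sJ1 sJ2 mA ->]]]]] [K1 [B1 [K2 [B2 [sK1 sK2 mB ->]]]]].
(* A coordinate outside one of the two index sets gets the vacuous constraint [setT] from it. *)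
pose join (I : choiceType) (V : Type) (J K : {fset I}) (A B : I -> set V) i :=
  (if i \in J then A i else setT) `&` (if i \in K then B i else setT).
have joinE (I : choiceType) (V : Type) (J K : {fset I}) (A B : I -> set V) (y : I -> V) :
    (forall i, i \in (J `|` K)%fset -> join I V J K A B i (y i)) <->
    (forall i, i \in J -> A i (y i)) /\ (forall i, i \in K -> B i (y i)).
  split=> [H|[HA HB] i _].
    by split=> i iJ; have := H i; rewrite in_fsetU iJ ?orbT /join iJ => /(_ isT)[].
  rewrite /join; split; first by case: ifPn => // /HA.
  by case: ifPn => // /HB.
exists (J1 `|` K1)%fset, (join _ _ J1 K1 A1 B1), (J2 `|` K2)%fset, (join _ _ J2 K2 A2 B2).
split.
- by move=> u /=; rewrite in_fsetU => /orP[/sJ1|/sK1].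
- by move=> u /=; rewrite in_fsetU => /orP[/sJ2|/sK2].
- by move=> e; apply: measurableI; case: ifP.
- apply/seteqP; split=> [y [[? ?] [? ?]]|y [/joinE[? ?] /joinE[? ?]]] //.
  by split; apply/joinE.
Qed.

(** The environment as seen with [a] as the origin. *)
Definition translate (a : lattice d) (y : env) : env :=
  (fun u => y.1 (u + a), fun e => y.2 (e.1 + a, e.2 + a)).

End Environment.

(** * Parents and chains of descendants *)

Section Lineage.
Context {R : realType} {d : nat}.
Notation env := (@env R d).
Implicit Types (y : env) (a u v : lattice d).

(* Relational form of [ancestor]: whereas the choice made by [xget] among tied
   minimisers need not commute with translations, this relation does. *)
Definition parent y u v : Prop :=
  nearest y.1 u v /\ forall v', nearest y.1 u v' -> y.2 (u, v) <= y.2 (u, v').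

(** Openness is asked at the top of the chain; further down it comes from [parent], since a nearest
    site is open. *)
Fixpoint lineage (n : nat) y v : Prop :=
  if n is m.+1 then exists u, parent y u v /\ lineage m y u else y.1 v = true.

Lemma nearest_height y u v : nearest y.1 u v -> height v = height u - 1.
Proof. by case=> -[]. Qed.

Lemma nearest_translate a y u v :
  nearest (translate a y).1 u v <-> nearest y.1 (u + a) (v + a).
Proof.
have bE x : open_below (translate a y).1 u x <-> open_below y.1 (u + a) (x + a).
  rewrite /open_below /open_vertices /= !height_add.
  by split=> -[? h]; split=> //; rewrite /= ?h in h *; lia.
split=> -[/bE bv min]; split=> // v' bv'.
  have := min (v' - a); rewrite -(l1_dist_add _ a u) -(l1_dist_add _ a u) subrK.
  by apply; apply/bE; rewrite subrK.
by have := min (v' + a); rewrite !l1_dist_add; apply; apply/bE.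
Qed.

Lemma parent_translate a y u v : parent (translate a y) u v <-> parent y (u + a) (v + a).
Proof.
split=> -[/nearest_translate nv min]; split=> // v' nv'.
  have := min (v' - a); rewrite /= subrK; apply.
  by apply/nearest_translate; rewrite subrK.
by apply: min; exact/nearest_translate.
Qed.

Lemma lineage_translate a n y v : lineage n (translate a y) v <-> lineage n y (v + a).
Proof.
elim: n v => [|n IH] v //=; split=> -[u [pu lu]].
  by exists (u + a); split; [exact/parent_translate|exact/IH].
by exists (u - a); split; [apply/parent_translate|apply/IH]; rewrite subrK.
Qed.

(* Going along the path, an upward step is never followed by a downward one, so
   either some vertex starts an upward ray or the whole path goes down. *)
Lemma path_lineage y (x : int -> lattice d) : bi_infinite_path y.1 y.2 x ->
  exists v, forall n, lineage n y v.
Proof.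
move=> [xI xo xe].
have neq k : x k <> x (k + 1) by move=> /xI; lia.
pose anc := ancestor y.1 y.2.
(* [ancestor] returns its default [u] when there is no minimiser; distinctness of consecutive path
   vertices excludes this. *)
have anc_parent u v : u <> v -> v = anc u -> parent y u v.
  move=> uv; have [[v' pv']|none] := pselect (exists v', parent y u v').
    by move=> ->; exact: (xgetPex u (ex_intro _ v' pv')).
  by rewrite /anc /ancestor xgetPN ?uv// => [/esym//|v' pv']; apply: none; exists v'.
have step k : x (k + 1) = anc (x k) \/ x k = anc (x (k + 1)).
  by case: (xe k) => u _ [[-> ->]|[-> ->]]; [left|right].
have [[k0 up0]|down] := pselect (exists k, x k = anc (x (k + 1))).
- have up (j : nat) : x (k0 + j%:Z) = anc (x (k0 + j%:Z + 1)).
    elim: j => [|j IH]; first by rewrite addr0.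
    have -> : k0 + j.+1%:Z = k0 + j%:Z + 1 by lia.
    (* A downward step here would lead back to the ancestor just left, against injectivity. *)
    by have [dn|//] := step (k0 + j%:Z + 1); move: IH; rewrite -dn => /xI; lia.
  exists (x k0) => n; have : forall j : nat, lineage n y (x (k0 + j%:Z)).
    elim: n => [j|n IH j /=]; first exact: xo.
    exists (x (k0 + j.+1%:Z)); split=> //.
    have -> : k0 + j.+1%:Z = k0 + j%:Z + 1 by lia.
    by apply: anc_parent (up j); exact/nesym/neq.
  by move=> /(_ 0%N); rewrite addr0.
(* When all steps go down, the descendants of [x 0] are found by following the path backwards. *)
- exists (x 0) => n; have : forall k, lineage n y (x k).
    elim: n => [k|n IH k /=]; first exact: xo.
    exists (x (k - 1)); split=> //; apply: anc_parent.
      by have := neq (k - 1); rewrite subrK.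
    have [] := step (k - 1); rewrite subrK// => up.
    by case: down; exists (k - 1); rewrite subrK.
  exact.
Qed.

(** * Measurability of lineage events *)

(** Events decided by the levels at and above [h]. Lineages look only upwards, which later makes
    them independent of lower sites. *)
Definition from_height h : set (set env) := <<s cylinders_above h >>.

Lemma from_height_not h B : from_height h B -> from_height h (~` B).
Proof. by move=> mB; rewrite -setTD; exact: sigma_algebraCD. Qed.

Lemma from_height_const h (C : Prop) : from_height h [set _ | C].
Proof.
have [c|nc] := pselect C.
- rewrite (_ : [set _ | C] = ~` set0); first by apply: from_height_not; exact: sigma_algebra0.
  by apply/seteqP; split=> // y _ [].
- rewrite (_ : [set _ | C] = set0); first exact: sigma_algebra0.
  by apply/seteqP; split=> [y /nc|y []].
Qed.

Lemma from_height_exists h (I : countType) (B : I -> set env) :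
  (forall i, from_height h (B i)) -> from_height h [set y | exists i, B i y].
Proof.
(* The countable type is enumerated by its codes; a number that codes nothing contributes the empty
   set. *)
move=> mB; pose F n := if pickle_inv n is Some i then B i else set0.
rewrite (_ : [set y | _] = \bigcup_n F n).
  apply: sigma_algebra_bigcup => n; rewrite /F; case: pickle_inv => [i|]; first exact: mB.
  exact: sigma_algebra0.
apply/seteqP; split=> [y [i Bi]|y [n _]]; last first.
  by rewrite /F; case: pickle_inv => // i Bi; exists i.
by exists (choice.pickle i) => //; rewrite /F choice.pickleK_inv.
Qed.

Lemma from_height_forall h (I : countType) (B : I -> set env) :
  (forall i, from_height h (B i)) -> from_height h [set y | forall i, B i y].
Proof.
move=> mB; rewrite (_ : [set y | _] = ~` [set y | exists i, (~` B i) y]).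
  apply: from_height_not; apply: from_height_exists => i; exact: from_height_not.
apply/seteqP; split=> [y By [i]|y nB i]; first exact.
by apply: contrapT => nBi; apply: nB; exists i.
Qed.

Lemma from_height_and h (A B : set env) :
  from_height h A -> from_height h B -> from_height h [set y | A y /\ B y].
Proof.
move=> mA mB; have := @from_height_forall h bool (fun b => if b then A else B).
rewrite (_ : [set y | _] = [set y | A y /\ B y]); first by apply; case.
by apply/seteqP; split=> [y H|y [Ay By] []]//; split; [exact: (H true)|exact: (H false)].
Qed.

Lemma from_height_imp h (A B : set env) :
  from_height h A -> from_height h B -> from_height h [set y | A y -> B y].
Proof.
move=> mA mB; rewrite (_ : [set y | _] = ~` [set y | A y /\ (~` B) y]).
  apply: from_height_not; apply: from_height_and => //; exact: from_height_not.
apply/seteqP; split=> [y AB [Ay]|y nAB Ay]; first by apply; exact: AB.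
by apply: contrapT => nB; exact: nAB.
Qed.

Lemma from_height_open h v : h <= height v -> from_height h [set y | y.1 v = true].
Proof.
move=> hv; apply: sub_sigma_algebra.
exists [fset v]%fset, (fun=> [set true]), fset0, (fun=> setT); split=> //.
- by move=> u /=; rewrite inE => /eqP ->.
- apply/seteqP; split=> [y yv|y [yv _]]; last by apply: yv; rewrite inE.
  by split=> // u; rewrite inE => /eqP ->.
Qed.

Lemma from_height_edge h e (A : set R) : edges_above h e -> measurable A ->
  from_height h [set y | A (y.2 e)].
Proof.
move=> he mA; apply: sub_sigma_algebra.
exists fset0, (fun=> setT), [fset e]%fset, (fun=> A); split=> //.
  by move=> f /=; rewrite inE => /eqP ->.
apply/seteqP; split=> [y ye|y [_ ye]]; last by apply: ye; rewrite inE.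
by split=> // f; rewrite inE => /eqP ->.
Qed.

(** The opposite strict inequality is witnessed by a rational between the two values, hence is a
    countable union of conditions on single edges. *)
Lemma from_height_tie_break h e e' : edges_above h e -> edges_above h e' ->
  from_height h [set y | y.2 e <= y.2 e'].
Proof.
move=> he he'.
have -> : [set y : env | y.2 e <= y.2 e'] =
    ~` [set y | exists q : rat, `]-oo, ratr q[%classic (y.2 e') /\
                                `]ratr q, +oo[%classic (y.2 e)].
  apply/seteqP; split=> [y /= le [q]|y nex /=].
    rewrite /= !in_itv /= andbT => -[e'q qe].
    by have := lt_trans e'q qe; rewrite ltNge le.
  rewrite leNgt; apply/negP => /rat_in_itvoo[q]; rewrite in_itv/= => /andP[e'q qe].
  by apply: nex; exists q; rewrite /= !in_itv /= e'q qe.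
apply: from_height_not; apply: from_height_exists => q.
by apply: from_height_and; exact: from_height_edge.
Qed.

Lemma from_height_nearest h u v : h <= height u - 1 ->
  from_height h [set y | nearest y.1 u v].
Proof.
move=> hu.
have mb v' : from_height h [set y | open_below y.1 u v'].
  have [hv'|hv'] := pselect (height v' = height u - 1).
    by apply: from_height_and; [apply: from_height_open; rewrite hv'|exact: from_height_const].
  rewrite (_ : [set y | _] = set0); first exact: sigma_algebra0.
  by apply/seteqP; split=> // y [].
apply: (@from_height_and h [set y | open_below y.1 u v]); first exact: mb.
apply: (@from_height_forall h _
  (fun v' => [set y | open_below y.1 u v' -> l1_dist u v <= l1_dist u v'])) => v'.
apply: (@from_height_imp h [set y | open_below y.1 u v']); first exact: mb.
exact: from_height_const.
Qed.

Lemma from_height_parent h u v : h <= height v -> from_height h [set y | parent y u v].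
Proof.
have [hv hh|hv _] := pselect (height v = height u - 1); last first.
  rewrite (_ : [set y | _] = set0); first exact: sigma_algebra0.
  by apply/seteqP; split=> // y [/nearest_height].
have hu : h <= height u - 1 by rewrite -hv.
apply: (@from_height_and h [set y | nearest y.1 u v]); first exact: from_height_nearest.
apply: (@from_height_forall h _
  (fun v' => [set y | nearest y.1 u v' -> y.2 (u, v) <= y.2 (u, v')])) => v'.
have [hv'|hv'] := pselect (height v' = height u - 1).
  apply: (@from_height_imp h [set y | nearest y.1 u v']); first exact: from_height_nearest.
  by apply: from_height_tie_break; split; rewrite /one_below/= ?hv ?hv'.
rewrite (_ : [set y | _] = [set _ | True]); first exact: from_height_const.
by apply/seteqP; split=> // y _ /nearest_height.
Qed.

(** Children lie one level higher, so the induction stays at or above [h]. *)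
Lemma from_height_lineage h n v : h <= height v -> from_height h [set y | lineage n y v].
Proof.
elim: n v => [|n IH] v hv /=; first exact: from_height_open.
apply: (@from_height_exists h _ (fun u => [set y | parent y u v /\ lineage n y u])) => u.
have [hu|hu] := pselect (height v = height u - 1).
  by apply: from_height_and; [exact: from_height_parent|apply: IH; lia].
rewrite (_ : [set y | _] = set0); first exact: sigma_algebra0.
by apply/seteqP; split=> // y [[/nearest_height]].
Qed.

End Lineage.

(** * Forcing a common parent *)

Lemma finite_l1_ball {d : nat} (u : lattice d) (r : int) :
  finite_set [set v : lattice d | l1_dist u v <= r].
Proof.
(* The number of integers from [-|r|] to [|r|], the range of each coordinate of [v - u]. *)
pose m := (`|r|.*2.+1)%N.
pose F (f : {ffun 'I_d -> 'I_m}) : lattice d := [ffun i => u i + (f i : nat)%:Z - `|r|%N%:Z].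
have fF : finite_set (F @` setT) by exact: finite_image.
apply: sub_finite_set fF.
move=> v /= uv.
have bound i : `|v i - u i| <= r.
  apply: (le_trans _ uv); rewrite /l1_dist (bigD1 i)//= lerDl.
  by apply: sumr_ge0.
have lt_m i : (absz (v i - u i + `|r|%N%:Z)%R < m)%N.
  by have := bound i; rewrite /m; lia.
exists [ffun i => Ordinal (lt_m i)] => //.
by apply/ffunP => i; rewrite !ffunE /=; have := bound i; lia.
Qed.

Section CommonParent.
Context {R : realType} {d : nat}.
Variables u1 u2 v : lattice d.

(* The sites that could replace v as a nearest site below u1 or u2. *)
Definition competitors : {fset lattice d} :=
  fset_set [set x | height x = height v /\
                    (l1_dist u1 x <= l1_dist u1 v \/ l1_dist u2 x <= l1_dist u2 v)].

Definition lone (x : lattice d) : set bool := [set b | b = (x == v)].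

Lemma in_competitors x : x \in competitors <->
  height x = height v /\ (l1_dist u1 x <= l1_dist u1 v \/ l1_dist u2 x <= l1_dist u2 v).
Proof.
rewrite in_fset_set; first by rewrite inE.
apply: (@sub_finite_set _ _ ([set x | l1_dist u1 x <= l1_dist u1 v] `|`
                             [set x | l1_dist u2 x <= l1_dist u2 v])).
  by move=> x' /= [_].
by rewrite finite_setU; split; exact: finite_l1_ball.
Qed.

(** With all other competitors closed, [v] is the only nearest open site, so the tie-break has a
    single candidate. *)
Lemma lone_parent (y : @env R d) u : u = u1 \/ u = u2 -> height v = height u - 1 ->
  (forall x, x \in competitors -> lone x (y.1 x)) -> parent y u v.
Proof.
move=> uu hv H.
have uniq v' : open_below y.1 u v' -> l1_dist u v' <= l1_dist u v -> v' = v.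
  move=> [ov' hv'] le; have /H : v' \in competitors.
    apply/in_competitors; split; first by rewrite hv.
    by case: uu => <-; [left|right].
  by rewrite /lone /= ov' => /esym/eqP.
have ov : open_below y.1 u v.
  split=> //; have /H : v \in competitors by apply/in_competitors; split=> //; left.
  by rewrite /lone /= eqxx.
split.
  split=> // v' bv'; rewrite leNgt; apply/negP => lt.
  by move: (lt); rewrite (uniq v' bv' (ltW lt)) ltxx.
by move=> v' [bv' min]; rewrite (uniq v' bv' (min _ ov)).
Qed.
End CommonParent.

(** * Law of the environment: translation invariance and independence *)

Section Law.
Context {R : realType} {d : nat} {p : R} {P : probability (config d) R}
  {dX : measure_display} {Xi : measurableType dX} {mu : probability Xi R}
  {U : lattice d * lattice d -> {RV mu >-> R}}.
Hypotheses (p01 : 0 < p < 1) (P_prod : is_bernoulli_product p P)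
  (U_iid : iid_uniform01 U).
Notation env := (@env R d).
Notation Pr := (P \x mu)%E.

Definition sample (z : config d * Xi) : env := (z.1, fun e => U e z.2).

Lemma product_setT : Pr setT = 1%E.
Proof.
have PT : P setT = 1%E := probability_setT P.
have muT : mu setT = 1%E := probability_setT mu.
transitivity (P setT * mu setT)%E; last by rewrite PT muT mule1.
by rewrite -product_measure1E// setXTT.
Qed.

Lemma product_lty : (Pr setT < +oo)%E.
Proof. by rewrite product_setT ltry. Qed.

Lemma measurable_site (u : lattice d) (A : set bool) :
  measurable ((fun w : config d => w u) @^-1` A).
Proof.
by apply: sub_sigma_algebra; exists u => //; exists A => //; rewrite setTI.
Qed.

Lemma site_law (u v : lattice d) (A : set bool) :
  P ((fun w : config d => w u) @^-1` A) = P ((fun w : config d => w v) @^-1` A).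
Proof.
have HT (x : lattice d) : P ((fun w : config d => w x) @^-1` [set true]) = p%:E.
  exact: P_prod.2.
have HF (x : lattice d) : P ((fun w : config d => w x) @^-1` [set false]) = (1 - p%:E)%E.
  rewrite -(HT x) -probability_setC; last exact: measurable_site.
  by congr (P _); apply/seteqP; split=> w /=; case: (w x).
have [] := set_bool A => /eqP ->.
- by rewrite !HT.
- by rewrite !HF.
- by rewrite !preimage_set0.
- by rewrite !preimage_setT.
Qed.

Lemma edge_law e e' (A : set R) : one_below e -> one_below e' -> measurable A ->
  mu (U e @^-1` A) = mu (U e' @^-1` A).
Proof.
by move=> be be' mA; rewrite (U_iid.2 e be A mA) (U_iid.2 e' be' A mA).
Qed.

Definition site_event (J : {fset lattice d}) (A : lattice d -> set bool) : set (config d) :=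
  \bigcap_(u in [set` J]) (fun w : config d => w u) @^-1` A u.

Definition edge_event (J : {fset lattice d * lattice d}) (A : lattice d * lattice d -> set R) :
  set Xi := \bigcap_(e in [set` J]) U e @^-1` A e.

Lemma sample_cylinder J1 A1 J2 A2 :
  sample @^-1` cylinder J1 A1 J2 A2 = site_event J1 A1 `*` edge_event J2 A2.
Proof. by []. Qed.

Lemma measurable_site_event J A : measurable (site_event J A).
Proof.
by apply: fin_bigcap_measurable => [|u _]; [exact: finite_fset|exact: measurable_site].
Qed.

Lemma measurable_edge_event J A : (forall e, measurable (A e)) -> measurable (edge_event J A).
Proof.
move=> mA; apply: fin_bigcap_measurable => [|e _]; first exact: finite_fset.
by rewrite -[X in measurable X]setTI; apply: measurable_funP.
Qed.

(** On a cylinder both sides are rectangles, with probabilities that are products of one-coordinate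
    laws, and these are the same at all sites and at all edges. The pi-lambda argument extends the
    equality. *)
Lemma translate_invariant (a : lattice d) h B : <<s cylinders_above h >> B ->
  [/\ measurable (sample @^-1` B), measurable (sample @^-1` (translate a @^-1` B)) &
      Pr (sample @^-1` B) = Pr (sample @^-1` (translate a @^-1` B))].
Proof.
apply: (@pi_lambda_agree _ _ _ Pr Pr _ sample (translate a \o sample)) => //.
- exact: cylinders_above_setI.
- exact: product_lty.
move=> _ [J1 [A1 [J2 [A2 [sJ1 sJ2 mA ->]]]]].
pose S := \bigcap_(u in [set` J1]) (fun w : config d => w (u + a)) @^-1` A1 u.
pose E := \bigcap_(e in [set` J2]) U (e.1 + a, e.2 + a) @^-1` A2 e.
have -> : (translate a \o sample) @^-1` cylinder J1 A1 J2 A2 = S `*` E by [].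
have mS : measurable S.
  by apply: fin_bigcap_measurable => [|u _]; [exact: finite_fset|exact: measurable_site].
have mE : measurable E.
  apply: fin_bigcap_measurable => [|e _]; first exact: finite_fset.
  by rewrite -[X in measurable X]setTI; apply: measurable_funP.
have mS0 := measurable_site_event J1 A1.
have mE0 := measurable_edge_event J2 A2 mA.
rewrite sample_cylinder; split; [exact: measurableX|exact: measurableX|].
rewrite [LHS]product_measure1E// [RHS]product_measure1E//; congr (_ * _)%E.
- have I := @mutually_independent_reindex _ _ _ _ _ P _ setT setT _ (fun u => u + a) _
     (addrK a) (fun _ _ => Logic.I) P_prod.1.
  apply: (etrans (P_prod.1 J1 A1 _ _)) => //.
  apply/esym/(etrans (I J1 A1 _ _)) => //.
  by apply: eq_bigr => u _; exact: site_law.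
- have ob e : one_below e -> one_below (e.1 + a, e.2 + a).
    by rewrite /one_below /= !height_add => ->; rewrite addrAC.
  have fK : cancel (fun e : lattice d * lattice d => (e.1 + a, e.2 + a))
                   (fun e => (e.1 - a, e.2 - a)).
    by move=> [x y]; rewrite /= !addrK.
  have I := @mutually_independent_reindex _ _ _ _ _ mu _ _ _ _ _ _ fK ob U_iid.1.
  have bJ2 : [set` J2] `<=` one_below by move=> e /sJ2[].
  apply: (etrans (U_iid.1 J2 A2 bJ2 _)) => //.
  apply/esym/(etrans (I J2 A2 bJ2 _)) => //.
  rewrite big_seq [RHS]big_seq; apply: eq_bigr => e /sJ2[eb _].
  by apply: edge_law => //; exact: ob.
Qed.

Lemma site_event_prod J (A : lattice d -> set bool) :
  P (site_event J A) = (\prod_(u <- J) P ((fun w : config d => w u) @^-1` A u))%E.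
Proof. exact: P_prod.1. Qed.

(** As [0 < p < 1], each state of a site has positive probability, and independence gives a finite
    product of positive factors. *)
Lemma site_event_gt0 J (A : lattice d -> set bool) : (forall u, A u !=set0) ->
  (0 < P (site_event J A))%E.
Proof.
move=> A0; rewrite site_event_prod.
apply: (big_ind (fun x : \bar R => (0 < x)%E)) => //; first by move=> x y; exact: mule_gt0.
move=> u _; have [b Ab] := A0 u.
have mS := measurable_site u.
have pos : (0 < P ((fun w : config d => w u) @^-1` [set b]))%E.
  have HT : P ((fun w : config d => w u) @^-1` [set true]) = p%:E by exact: P_prod.2.
  have [p0 p1] := andP p01.
  case: b {Ab} => //; first by rewrite HT lte_fin.
  have -> : (fun w : config d => w u) @^-1` [set false] =
      ~` ((fun w : config d => w u) @^-1` [set true]).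
    by apply/seteqP; split=> w /=; case: (w u).
  rewrite probability_setC//.
  have -> : P ((fun w : config d => w u) @^-1` [set true]) = p%:E by [].
  by rewrite -EFinB lte_fin subr_gt0.
apply: (lt_le_trans pos); apply: le_measure; rewrite ?inE; [exact: mS|exact: mS|].
by move=> w /= ->.
Qed.

(** With the site event fixed, both sides are finite measures in [B]. They agree on cylinders, whose
    sites all lie at height at least [h], and hence on the generated sigma-algebra. *)
Lemma site_event_independent h J0 (A0 : lattice d -> set bool) B :
  <<s cylinders_above h >> B -> (forall u, u \in J0 -> height u < h) ->
  Pr ((sample @^-1` B) `&` (site_event J0 A0 `*` setT)) =
  (P (site_event J0 A0) * Pr (sample @^-1` B))%E.
Proof.
move=> sB J0h.
have mC0 := measurable_site_event J0 A0.
have mC : measurable (site_event J0 A0 `*` [set: Xi]) by exact: measurableX.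
have PC0 : (0 <= fine (P (site_event J0 A0)))%R by exact: fine_ge0.
have PCE : (fine (P (site_event J0 A0)))%:E = P (site_event J0 A0).
  by rewrite fineK// fin_num_measure.
have PrC : Pr (site_event J0 A0 `*` [set: Xi]) = P (site_event J0 A0).
  rewrite [LHS]product_measure1E//.
  rewrite [X in (_ * X)%E](_ : _ = 1%E) ?mule1//.
  exact: probability_setT.
pose m1 := mrestr Pr mC.
pose m2 := mscale (NngNum PC0) Pr.
have m1E X : m1 X = Pr (X `&` (site_event J0 A0 `*` setT)) by [].
have m2E X : m2 X = (P (site_event J0 A0) * Pr X)%E by rewrite /m2 /mscale/= PCE.
have m1T : m1 setT = P (site_event J0 A0) by rewrite m1E setTI.
have m1oo : (m1 setT < +oo)%E by rewrite m1T -PCE ltry.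
have m12T : m1 setT = m2 setT.
  by rewrite m1T m2E [X in (_ * X)%E]product_setT mule1.
suff [_ _] : [/\ measurable (sample @^-1` B), measurable (sample @^-1` B) &
    m1 (sample @^-1` B) = m2 (sample @^-1` B)].
  by rewrite m1E m2E.
apply: (@pi_lambda_agree _ _ _ m1 m2 _ sample sample) sB.
- exact: cylinders_above_setI.
- exact: m1oo.
- exact: m12T.
move=> _ [J1 [A1 [J2 [A2 [sJ1 sJ2 mA ->]]]]].
have mS0 := measurable_site_event J1 A1.
have mE0 : measurable (edge_event J2 A2) by exact: measurable_edge_event.
rewrite sample_cylinder; split; [exact: measurableX|exact: measurableX|].
apply: (etrans (m1E _)); apply: (etrans _ (esym (m2E _))).
rewrite -setXI setIT.
have mI : measurable (site_event J1 A1 `&` site_event J0 A0) by exact: measurableI.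
apply: (etrans (product_measure1E _ _ _ _)) => //.
have -> : Pr (site_event J1 A1 `*` edge_event J2 A2) =
  (P (site_event J1 A1) * mu (edge_event J2 A2))%E by exact: product_measure1E.
rewrite muleA; congr (_ * _)%E.
(* The two index sets are disjoint, being separated by height, so both constraints merge into one
   family. *)
pose A u := if u \in J1 then A1 u else A0 u.
have J01 u : u \in J0 -> (u \in J1) = false.
  move=> uJ0; apply/negP => /sJ1; rewrite /sites_above /=.
  by rewrite leNgt J0h.
have -> : site_event J1 A1 `&` site_event J0 A0 = site_event (J1 `|` J0)%fset A.
  apply/seteqP; split=> [w [w1 w0] u /=|w wA].
    rewrite in_fsetU /A => /orP[uJ1|uJ0]; first by rewrite uJ1; exact: w1.
    by rewrite J01//; exact: w0.
  split=> u /= uJ; have := wA u; rewrite /= in_fsetU uJ ?orbT /A.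
    by rewrite uJ; apply.
  by rewrite J01//; apply.
rewrite !site_event_prod; apply: (etrans (site_event_prod _ _)).
rewrite (big_fsetID _ (mem J1))/= muleC; congr (_ * _)%E.
- apply: eq_fbig => u.
    rewrite !inE /=; have [uJ0|uJ0] := boolP (u \in J0); first by rewrite J01// orbT.
    by case: (u \in J1).
  by rewrite !inE => /andP[_ /negPf uJ1]; rewrite /A uJ1.
- apply: eq_fbig => u; first by rewrite !inE; case: (u \in J1); rewrite ?andbF.
  by rewrite !inE => /andP[_ uJ1]; rewrite /A uJ1.
Qed.

(** * Ties between edge variables are null *)

Lemma edge_interval e (a b : R) : one_below e -> a < b ->
  (mu (U e @^-1` `]a, b]%classic) <= (b - a)%:E)%E.
Proof.
move=> be ab; rewrite (U_iid.2 e be _ (measurable_itv _)).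
apply: (le_trans (measureIl lebesgue_measure _ _)) => //.
have := lebesgue_measure_itv (`]a, b] : interval R).
by rewrite /= lte_fin ab -EFinB => <-.
Qed.

Lemma edge_outside e : one_below e -> mu (U e @^-1` (~` `]0, 1]%classic)) = 0%E.
Proof.
move=> be; rewrite (U_iid.2 e be); last by apply: measurableC.
by rewrite setICl measure0.
Qed.

Lemma edge_pair e e' (A : set R) : one_below e -> one_below e' -> e <> e' ->
  measurable A ->
  mu (U e @^-1` A `&` U e' @^-1` A) = (mu (U e @^-1` A) * mu (U e' @^-1` A))%E.
Proof.
move=> be be' ee' mA.
have := U_iid.1 [fset e; e']%fset (fun=> A).
rewrite big_fsetU1/=; last by rewrite inE; apply/eqP.
rewrite big_seq_fset1 => <- //; last by move=> i /=; rewrite !inE => /orP[] /eqP ->.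
congr (mu _); apply/seteqP; split=> [x [? ?] i /=|x H].
  by rewrite !inE => /orP[] /eqP ->.
by split; apply: H; rewrite /= !inE eqxx ?orbT.
Qed.

Lemma measurable_tie e e' : measurable [set x | U e x = U e' x].
Proof.
have := @measurable_realfun.measurable_fun_eqr _ Xi R setT (U e) (U e')
  (measurable_funPT (U e)) (measurable_funPT (U e')).
move=> /(_ measurableT [set true] I); rewrite setTI.
by congr (measurable _); apply/seteqP; split=> x /= /eqP.
Qed.

(* Cut ]0, 1] into n.+1 intervals: a tie puts both variables into the same one. *)
Lemma tie_null e e' : one_below e -> one_below e' -> e <> e' ->
  mu [set x | U e x = U e' x] = 0%E.
Proof.
move=> be be' ee'; set T := [set x | _].
have mT : measurable T by exact: measurable_tie.
have mU (A : set R) f : measurable A -> measurable (U f @^-1` A).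
  by move=> mA; rewrite -[X in measurable X]setTI; apply: measurable_funP.
suff bound (n : nat) : (mu T <= (n.+1%:R^-1)%:E)%E.
  have finT : mu T \is a fin_num by exact: fin_num_measure.
  apply/eqP; rewrite eq_le measure_ge0 andbT -(fineK finT) lee_fin leNgt.
  apply/negP => r0; have := bound (Num.trunc (fine (mu T))^-1).
  rewrite -(fineK finT) lee_fin leNgt => /negP; apply.
  rewrite invf_plt ?posrE ?ltr0n//.
  exact: Num.Theory.truncnS_gt.
pose N := n.+1%:R : R; have N0 : 0 < N by rewrite ltr0n.
pose I (k : nat) := `]k%:R / N, k.+1%:R / N]%classic : set R.
have mI k : measurable (I k) by exact: measurable_itv.
pose F k := U e @^-1` I k `&` U e' @^-1` I k.
have mF k : measurable (F k) by apply: measurableI; exact: mU.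
(* Independence squares the interval length [N^-1]; the [N] terms together leave [N^-1]. *)
have FN k : (mu (F k) <= (N^-1 * N^-1)%:E)%E.
  rewrite /F edge_pair// EFinM.
  have kN : k%:R / N < k.+1%:R / N by rewrite ltr_pM2r ?invr_gt0// ltr_nat.
  have kE : k.+1%:R / N - k%:R / N = N^-1 by rewrite -mulrBl -natrB// subSnn mul1r.
  by apply: lee_pmul; rewrite ?measure_ge0// -kE; exact: edge_interval.
have cover : T `<=` U e @^-1` (~` `]0, 1]%classic) `|` \big[setU/set0]_(k < n.+1) F k.
  move=> x Tx; have [x01|] := pselect (`]0, 1]%classic (U e x)); last by left.
  right; rewrite -bigcup_mkord.
  move: x01; rewrite /= in_itv/= => /andP[x0 x1].
  (* The least such [k] indexes the interval containing [U e x]: minimality gives the strict lower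
     bound, and for [k = 0] positivity of [U e x] does. *)
  have ex : exists k : nat, U e x * N <= k.+1%:R.
    by exists n; rewrite ler_piMl// ltW.
  case: (ex_minnP ex) => k xk kmin.
  have kn : (k < n.+1)%N by rewrite ltnS; apply: kmin; rewrite ler_piMl// ltW.
  have Ik : I k (U e x).
    rewrite /I /= in_itv/= ltr_pdivrMr// ler_pdivlMr// xk andbT.
    case: k xk kmin kn => [|k] xk kmin kn; first by rewrite mulr_gt0.
    by rewrite ltNge; apply/negP => /kmin; rewrite ltnn.
  by exists k => //; split => //=; rewrite -Tx.
have mS : measurable (\big[setU/set0]_(k < n.+1) F k).
  by apply: bigsetU_measurable.
have mO : measurable (U e @^-1` (~` `]0, 1]%classic)).
  by apply: mU; apply: measurableC; exact: measurable_itv.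
apply: (le_trans (le_measure mu _ _ cover)); rewrite ?inE//; first exact: measurableU.
apply: (le_trans (measureU2 _ _ _)) => //.
rewrite -[leRHS]add0e; apply: leeD.
  by rewrite le_eqVlt; apply/orP; left; apply/eqP; exact: edge_outside.
apply: (le_trans (le_mu_bigsetU mu (fun k _ => mF k))).
apply: (@le_trans _ _ (\sum_(k < n.+1) (N^-1 * N^-1)%:E)%E).
  by apply: lee_sum => k _; exact: FN.
rewrite sumEFin lee_fin sumr_const card_ord -[leLHS]mulr_natr -/N -mulrA mulVf ?mulr1//.
by rewrite gt_eqF.
Qed.

(** * Mass transport from children to parents *)

Definition prob (B : set env) : \bar R := Pr (sample @^-1` B).

Lemma measurable_sample h B : from_height h B -> measurable (sample @^-1` B).
Proof. by move=> mB; have [] := translate_invariant 0 _ _ mB. Qed.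

Lemma prob_translate h B a : from_height h B ->
  prob [set y | B (translate a y)] = prob B.
Proof. by move=> mB; have [] := translate_invariant a _ _ mB. Qed.

(** The event that [u] sends its mass to [v]. *)
Definition child_event n u v : set env := [set y | parent y u v /\ lineage n y u].

Lemma from_height_child n u v : from_height (height v) (child_event n u v).
Proof.
have [hu|hu] := pselect (height v = height u - 1); last first.
  rewrite (_ : child_event _ _ _ = set0); first exact: sigma_algebra0.
  by apply/seteqP; split=> // y [[/nearest_height]].
apply: (@from_height_and _ _ _ [set y | parent y u v]); first exact: from_height_parent.
by apply: from_height_lineage; lia.
Qed.

Lemma prob_lineage_translate n u v :
  prob [set y | lineage n y u] = prob [set y | lineage n y v].
Proof.
rewrite -(@prob_translate (height v) [set y | lineage n y v] (u - v)); last first.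
  exact: from_height_lineage.
by congr prob; apply/seteqP; split=> y /=; rewrite lineage_translate addrC subrK.
Qed.

Lemma prob_child_translate n u v a :
  prob (child_event n (u + a) (v + a)) = prob (child_event n u v).
Proof.
rewrite -(@prob_translate (height v) (child_event n u v) a); last exact: from_height_child.
congr prob; apply/seteqP; split=> y [/parent_translate pu /lineage_translate lu]; split=> //.
Qed.

(** Two distinct parents of [u] would have to tie in the tie-breaking variables, a null event. *)
Lemma prob_child_disjoint n u v v' : v <> v' ->
  prob (child_event n u v `&` child_event n u v') = 0%E.
Proof.
move=> vv'.
have [[hv hv']|nh] := pselect (one_below (u, v) /\ one_below (u, v')); last first.
  rewrite (_ : _ `&` _ = set0) ?/prob ?preimage_set0 ?measure0//.
  apply/seteqP; split=> // y [[[/nearest_height ? _] _] [[/nearest_height ? _] _]].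
  by exfalso; apply: nh.
pose T := [set x | U (u, v) x = U (u, v') x].
have mT : measurable T by exact: measurable_tie.
have T0 : Pr ([set: config d] `*` T) = 0%E.
  rewrite [LHS]product_measure1E// [X in (_ * X)%E](_ : _ = 0%E) ?mule0//.
  by apply: tie_null => // -[].
apply: (@subset_measure0 _ _ _ Pr _ _ _ _ _ T0).
- by apply: measurableI; apply: measurable_sample; exact: from_height_child.
- exact: measurableX.
- move=> z [[[nv min] _] [[nv' min'] _]]; split=> //; rewrite /T /=.
  by apply/eqP; rewrite eq_le; apply/andP; split; [exact: min|exact: min'].
Qed.

(* The mass received and the mass sent are both summed over the displacement s
   between child and parent, so that translation invariance matches the two series
   term by term. *)
Lemma lineage_transport n u1 u2 v : u1 <> u2 ->
  (prob [set y | lineage n.+1 y v] + prob (child_event n u1 v `&` child_event n u2 v)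
   <= prob [set y | lineage n y v])%E.
Proof.
move=> u12.
pose step (E : lattice d -> set env) k := if pickle_inv k is Some s then E s else set0.
pose In := step (fun s => child_event n (v + s) v).
pose Out := step (fun s => child_event n v (v - s)).
pose F k := sample @^-1` In k; pose G k := sample @^-1` Out k.
have mF k : measurable (F k).
  rewrite /F /In /step; case: pickle_inv => [s|]; last by rewrite preimage_set0.
  exact: measurable_sample (from_height_child _ _ _).
have mG k : measurable (G k).
  rewrite /G /Out /step; case: pickle_inv => [s|]; last by rewrite preimage_set0.
  exact: measurable_sample (from_height_child _ _ _).
have FG : (\sum_(0 <= k <oo) Pr (F k) = \sum_(0 <= k <oo) Pr (G k))%E.
  apply: eq_eseriesr => k _; rewrite /F /G /In /Out /step; case: pickle_inv => // s.
  by have := prob_child_translate n v (v - s) s; rewrite subrK.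
have mL m x : measurable (sample @^-1` [set y | lineage m y x]).
  exact: measurable_sample (from_height_lineage _ _ _ (lexx (height x))).
have InE u : In (choice.pickle (u - v)) = child_event n u v.
  by rewrite /In /step choice.pickleK_inv addrC subrK.
pose k1 := choice.pickle (u1 - v); pose k2 := choice.pickle (u2 - v).
have k12 : k1 <> k2.
  move=> /(pcan_inj choice.pickleK_inv)/(congr1 (fun x => x + v)).
  by rewrite !subrK.
(* Mass received: a chain of length [n.+1] needs some contributing child, and the event of receiving
   from both [u1] and [u2] is counted twice. *)
apply: (@le_trans _ _ (\sum_(0 <= k <oo) Pr (F k))%E).
  have := @subadditive_overlap _ _ _ Pr F (sample @^-1` [set y | lineage n.+1 y v]) k1 k2.
  rewrite {3 4}/F !InE; apply=> //; last exact: product_lty.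
  move=> z [u [pu lu]]; exists (choice.pickle (u - v)) => //.
  by rewrite /F /= InE.
(* Mass sent: [v] sends only when it has a chain of length [n], and almost surely to at most one
   parent. *)
rewrite FG; apply: almost_disjoint_series => //.
  move=> k z; rewrite /G /Out /step; case: pickle_inv => // s.
  by case.
move=> i j ij; rewrite /G /Out /step.
case Ei : (pickle_inv i) => [s|]; last by rewrite preimage_set0 set0I measure0.
case Ej : (pickle_inv j) => [t|]; last by rewrite preimage_set0 setI0 measure0.
apply: prob_child_disjoint => /addrI/oppr_inj st; apply: ij.
have inv k := @choice.pickle_invK (lattice d) k.
by rewrite -(inv i) -(inv j) Ei Ej st.
Qed.

(** * Eternal vertices have probability zero *)

Definition eternal v : set env := [set y | forall n, lineage n y v].

Lemma from_height_eternal v : from_height (height v) (eternal v).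
Proof.
apply: (@from_height_forall _ _ _ nat (fun n => [set y | lineage n y v])) => n.
exact: from_height_lineage.
Qed.

Lemma prob_eternal_translate u v : prob (eternal u) = prob (eternal v).
Proof.
rewrite -(@prob_translate (height v) (eternal v) (u - v)); last exact: from_height_eternal.
congr prob; apply/seteqP; split=> y /= H n; have := H n;
  by rewrite lineage_translate addrC subrK.
Qed.

Lemma measurable_eternal v : measurable (sample @^-1` eternal v).
Proof. exact: measurable_sample (from_height_eternal v). Qed.

Lemma prob_fin_num B h : from_height h B -> prob B \is a fin_num.
Proof.
move=> mB; rewrite ge0_fin_numE ?measure_ge0//.
apply: (le_lt_trans _ product_lty).
by apply: le_measure; rewrite ?inE//; exact: measurable_sample mB.
Qed.

(** In dimension at least two the first coordinate differs from the last, so it can vary while the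
    height stays fixed. *)
Lemma horizontal_line : (2 <= d)%N ->
  exists x : nat -> lattice d, injective x /\ forall k, height (x k) = 0.
Proof.
case: d => [|[|n]]// _.
exists (fun k => [ffun i => if i == ord0 then k%:Z else 0]); split.
  by move=> i j /ffunP/(_ ord0); rewrite !ffunE eqxx => -[].
by move=> k; rewrite /= ffunE.
Qed.

(** Otherwise the equally likely events along a horizontal line would be pairwise almost disjoint,
    and enough of them would have total mass above one. *)
Lemma two_eternal v : (2 <= d)%N -> prob (eternal v) != 0%E ->
  exists u1 u2, [/\ u1 <> u2, height u1 = height u2 &
    prob (eternal u1 `&` eternal u2) != 0%E].
Proof.
move=> d2 v0; have [x [xI xh]] := horizontal_line d2.
apply: contrapT => none.
have disj i j : i <> j -> prob (eternal (x i) `&` eternal (x j)) = 0%E.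
  move=> ij; apply/eqP/negPn/negP => h; apply: none.
  by exists (x i), (x j); split=> //; [move=> /xI|rewrite !xh].
have fin := prob_fin_num _ _ (from_height_eternal v).
pose r := fine (prob (eternal v)).
have r0 : 0 < r by rewrite fine_gt0// lt0e v0 measure_ge0 -ge0_fin_numE ?measure_ge0.
(* Chosen so that [N] times [r] exceeds one. *)
pose N := (Num.trunc r^-1).+1.
have := @almost_disjoint_series _ _ _ Pr (fun k => sample @^-1` eternal (x k)) setT
  measurableT (fun k => measurable_eternal (x k)) (fun _ _ _ => I) disj.
rewrite [leRHS]product_setT => le1.
have : (\sum_(0 <= k < N) prob (eternal (x k)) <= 1)%E.
  by apply: le_trans le1; apply: nneseries_lim_ge => *; exact: measure_ge0.
rewrite (eq_bigr (fun=> r%:E)); last first.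
  by move=> k _; rewrite (prob_eternal_translate _ v) /r fineK.
rewrite sumEFin lee_fin big_const_nat subn0 iter_addr_0 leNgt => /negP; apply.
rewrite -mulr_natr -ltr_pdivrMl// mulr1.
exact: Num.Theory.truncnS_gt.
Qed.

Lemma no_two_eternal u1 u2 : u1 <> u2 -> height u1 = height u2 -> (0 < d)%N ->
  prob (eternal u1 `&` eternal u2) = 0%E.
Proof.
move=> u12 hu d0; apply/eqP/negPn/negP => pos.
have [v hv] : exists v : lattice d, height v = height u1 - 1.
  have [b hb] : exists b : lattice d, height b = 1.
    case: d d0 => // n _; exists [ffun=> 1]; by rewrite /= ffunE.
  exists (u1 - b).
  have := height_add _ (u1 - b) b; rewrite subrK hb => ->; by rewrite addrK.
pose J := competitors u1 u2 v; pose C := site_event J (lone v).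
have mB : from_height (height u1) (eternal u1 `&` eternal u2).
  apply: (@from_height_and _ _ _ (eternal u1)); first exact: from_height_eternal.
  by rewrite hu; exact: from_height_eternal.
have mC : measurable (C `*` [set: Xi]).
  by apply: measurableX => //; exact: measurable_site_event.
pose D := sample @^-1` (eternal u1 `&` eternal u2) `&` (C `*` setT).
have mD : measurable D by apply: measurableI => //; exact: measurable_sample mB.
have D0 : (0 < Pr D)%E.
  (* Competitors lie one level below [u1] and [u2], hence outside what decides the two eternal
     events; this gives the independence. *)
  have Jlow x : x \in J -> height x < height u1.
    by move=> /in_competitors[-> _]; rewrite hv; lia.
  rewrite /D (site_event_independent _ _ _ _ mB Jlow).
  apply: mule_gt0; last by rewrite lt0e pos measure_ge0.
  by apply: site_event_gt0 => x; exists (x == v).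
have Dchild n : D `<=` sample @^-1` (child_event n u1 v `&` child_event n u2 v).
  move=> z [[e1 e2] [zC _]].
  have zP u : u = u1 \/ u = u2 -> parent (sample z) u v.
    move=> uu; apply: (lone_parent u1 u2) => //.
    by case: uu => ->; rewrite -?hu.
  split; first by split; [apply: zP; left|exact: e1].
  by split; [apply: zP; right|exact: e2].
pose q n := prob [set y | lineage n y v].
have mL n : from_height (height v) [set y : env | lineage n y v] by exact: from_height_lineage.
(* The loss [Pr D] is the same for every [n], because [D] involves chains of all lengths at once. *)
have decr n : (q n.+1 + Pr D <= q n)%E.
  apply: le_trans (lineage_transport n u1 u2 v u12); apply: leeD2l.
  apply: le_measure; rewrite ?inE//.
  by apply: measurableI; apply: measurable_sample; exact: from_height_child.
have finq n : q n \is a fin_num by exact: (prob_fin_num _ _ (mL n)).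
have finD : Pr D \is a fin_num.
  rewrite ge0_fin_numE ?measure_ge0//.
  apply: (le_lt_trans _ product_lty).
  by apply: le_measure; rewrite ?inE.
pose r := fine (Pr D); have r0 : 0 < r by rewrite fine_gt0// D0 -ge0_fin_numE ?measure_ge0.
have bound n : fine (q n) + r *+ n <= fine (q 0%N).
  elim: n => [|n IH]; first by rewrite addr0.
  apply: le_trans IH; rewrite mulrS addrA lerD2r.
  by rewrite -lee_fin EFinD !fineK.
(* After this many steps the accumulated loss exceeds [q 0], although [q] stays nonnegative. *)
have := bound (Num.trunc (fine (q 0%N) / r)).+1; apply/negP; rewrite -ltNge.
apply: (@lt_le_trans _ _ (r *+ (Num.trunc (fine (q 0%N) / r)).+1)).
  by rewrite -mulr_natr -ltr_pdivrMl// mulrC Num.Theory.truncnS_gt.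
by rewrite lerDr fine_ge0// measure_ge0.
Qed.

Lemma prob_eternal0 v : (2 <= d)%N -> prob (eternal v) = 0%E.
Proof.
move=> d2; apply/eqP/negPn/negP => /(two_eternal _ d2)[u1 [u2 [u12 hu]]].
by rewrite no_two_eternal ?eqxx//; exact: ltnW.
Qed.

End Law.

(** * Absence of bi-infinite paths *)

Theorem theorem2p2 (R : realType) (d : nat) (p : R)
    (p01 : 0 < p < 1) (d_ge2 : (2 <= d)%N)
    (P : probability (config d) R) (P_prod : is_bernoulli_product p P)
    (dX : measure_display) (Xi : measurableType dX) (mu : probability Xi R)
    (U : lattice d * lattice d -> {RV mu >-> R}) (U_iid : iid_uniform01 U) :
  {ae (P \x mu)%E, forall z : config d * Xi,
    ~ exists x : int -> lattice d,
        bi_infinite_path z.1 (fun e => U e z.2) x}.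
Proof.
pose F k :=
  if pickle_inv k is Some v then @sample R d dX Xi mu U @^-1` eternal v else set0.
(* A path forces some vertex to be eternal, so the exceptional set lies in a countable union of null
   events indexed by the codes of lattice sites. *)
apply: (@negligibleS _ _ _ _ (\bigcup_k F k)).
  move=> z /contrapT[x xP].
  have [v vP] := @path_lineage R d (sample (U := U) z) x xP.
  by exists (choice.pickle v) => //; rewrite /F choice.pickleK_inv.
apply: negligible_bigcup => k; rewrite /F.
case: pickle_inv => [v|]; last exact: negligible_set0.
have mv := measurable_eternal P_prod U_iid v.
apply/(negligibleP (P \x mu)%E mv).
exact: (prob_eternal0 p01 P_prod U_iid v d_ge2).
Qed.
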